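(* Let $L,M$ be nonnegative integers and $(a,b)$ a pair of coprime integers with $1\leq b<a$. Then \[ \sum_{j\in\mathbb{Z}}(-1)^j q^{abj^2}\mathcal{B}(L,M,aj,bj)=I_{a,b}(L,M), \] where for $a\le 2b$ \[I_{a,b}(L,M)=\sum_{m\in\mathbb Z_{\ge0}^d}q^{m^TCm}\begin{bmatrix}2L+M-m_1\\ 2L\end{bmatrix}\prod_{j=1}^d\begin{bmatrix}\tau_jm_j+n_j\\ \tau_jm_j\end{bmatrix}_{q^{3-\tau_j}},\] and for $a>2b$ \[I_{a,b}(L,M)=\sum_{m\in\mathbb Z_{\ge0}^d}q^{L(L-2m_1)+m^TCm}\begin{bmatrix}L+M+m_1\\ 2L\end{bmatrix}\prod_{j=1}^d\begin{bmatrix}\tau_jm_j+n_j\\ \tau_jm_j\end{bmatrix}_{q^{3-\tau_j}}.\]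
   Context: Notation: $(x;q)_n=\prod_{i=0}^{n-1}(1-xq^i)$, $(q)_n=(q;q)_n$; $\begin{bmatrix}N\\ m\end{bmatrix}=\begin{bmatrix}N\\ m\end{bmatrix}_q=\frac{(q)_N}{(q)_m(q)_{N-m}}$ if $m,N-m$ are nonnegative integers, $0$ otherwise, and $\begin{bmatrix}N\\ m\end{bmatrix}_{q^k}$ is the same with $q$ replaced by $q^k$. $\mathcal{B}(L,M,a,b)=\begin{bmatrix}L+M+a-b\\ L+a\end{bmatrix}\begin{bmatrix}L+M-a+b\\ L-a\end{bmatrix}$. Continued-fraction data: for coprime $1\le b<a$ let $\mathrm{cf}(a,b)=(a/b-1)^{s}$ with $s=1$ if $a>2b$, $s=-1$ if $a<2b$, $s=0$ if $a=2b$. Write $\mathrm{cf}(a,b)=[a_0,\dots,a_n]$ (regular continued fraction with positive integer partial quotients), choosing $a_n\ge 2$ when $(a,b)\ne(2,1)$ (and $\mathrm{cf}(2,1)=[1]$). Put $t_0=0$, $t_j=a_0+\dots+a_{j-1}$ ($1\le j\le n+1$), $d=t_{n+1}$. $\mathcal I$ is the $d\times d$ matrix with $\mathcal I_{j,k}=\delta_{j,k+1}+\delta_{j,k-1}$ if $j\notin\{t_1,\dots,t_{n+1}\}$ and $\delta_{j,k+1}+\delta_{j,k}-\delta_{j,k-1}$ otherwise; $C=2I-\mathcal I$. $\tau_j=2$ for $j<d$, $\tau_d=1$. For $m\in\mathbb Z_{\ge0}^d$: $m^TCm=\sum_{j,k}m_jC_{j,k}m_k$, $n_j=L\delta_{j,1}-\sum_kC_{j,k}m_k$.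 *)

(* Defs.v *)
From HB Require Import structures.
From mathcomp Require Import all_boot all_order all_algebra.
Set Implicit Arguments. Unset Strict Implicit. Unset Printing Implicit Defensive.
Import Order.TTheory GRing.Theory Num.Theory.
Local Open Scope ring_scope.

Definition qpoch {R : nzRingType} (x q : R) (n : nat) : R :=
  \prod_(i < n) (1 - x * q ^+ i).
Definition qfac {R : nzRingType} (q : R) (n : nat) : R := qpoch q q n.

Definition qbin {F : fieldType} (q : F) (N m : int) : F :=
  if (0 <= m) && (m <= N)
  then qfac q `|N|%N / (qfac q `|m|%N * qfac q `|N - m|%N)
  else 0.

Definition Bfun {F : fieldType} (q : F) (L M a b : int) : F :=
  qbin q (L + M + a - b) (L + a) * qbin q (L + M - a + b) (L - a).

Fixpoint cfval (s : seq nat) : rat :=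
  match s with
  | [::] => 0
  | x :: s' => if s' is [::] then x%:R else x%:R + (cfval s')^-1
  end.

Definition cf_sign (a b : nat) : int :=
  if (2 * b < a)%N then 1 else if (a < 2 * b)%N then -1 else 0.
Definition cfab (a b : nat) : rat := (a%:R / b%:R - 1) ^ (cf_sign a b).

Definition is_cf_expansion (a b : nat) (s : seq nat) : Prop :=
  [/\ s != [::], all (fun x => 0 < x)%N s, cfval s = cfab a b &
      (if (a == 2%N) && (b == 1%N) then s = [:: 1%N] else (2 <= last 0 s)%N)].

Definition tpos (s : seq nat) (j : nat) : nat := sumn (take j s).
Definition dim (s : seq nat) : nat := sumn s.
Definition isT (s : seq nat) (j : nat) : bool :=
  has (fun i => tpos s i == j) (iota 1 (size s)).

(** the matrix \mathcal I (1-based indices j, k) *)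
Definition Imat (s : seq nat) (j k : nat) : int :=
  if isT s j then (j == k.+1)%:Z + (j == k)%:Z - (j.+1 == k)%:Z
  else (j == k.+1)%:Z + (j.+1 == k)%:Z.
Definition Cmat (s : seq nat) (j k : nat) : int := 2 * (j == k)%:Z - Imat s j k.
Definition tau (s : seq nat) (j : nat) : nat := if (j < dim s)%N then 2 else 1.

Definition mj (m : seq nat) (j : nat) : int := (nth 0%N m j.-1)%:Z.

Definition mCm (s : seq nat) (m : seq nat) : int :=
  \sum_(1 <= j < (dim s).+1) \sum_(1 <= k < (dim s).+1) mj m j * Cmat s j k * mj m k.

Definition nvec (s : seq nat) (L : nat) (m : seq nat) (j : nat) : int :=
  L%:Z * (j == 1%N)%:Z - \sum_(1 <= k < (dim s).+1) Cmat s j k * mj m k.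

Definition lhs_term {F : fieldType} (q : F) (L M a b : nat) (j : int) : F :=
  (-1) ^ j * q ^ (a%:Z * b%:Z * j ^+ 2) * Bfun q L M (a%:Z * j) (b%:Z * j).

Definition rhs_term {F : fieldType} (q : F) (s : seq nat) (L M a b : nat)
    (m : (dim s).-tuple nat) : F :=
  let P := \prod_(1 <= j < (dim s).+1)
             qbin (q ^+ (3 - tau s j)) ((tau s j)%:Z * mj m j + nvec s L m j)
                  ((tau s j)%:Z * mj m j) in
  if (a <= 2 * b)%N then
    q ^ (mCm s m) * qbin q (2 * L%:Z + M%:Z - mj m 1) (2 * L%:Z) * P
  else
    q ^ (L%:Z * (L%:Z - 2 * mj m 1) + mCm s m)
      * qbin q (L%:Z + M%:Z + mj m 1) (2 * L%:Z) * P.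

Definition has_fsum {T : eqType} {R : nmodType} (f : T -> R) (v : R) : Prop :=
  exists S : seq T, [/\ uniq S, (forall x, x \notin S -> f x = 0) &
                        v = \sum_(x <- S) f x].

Arguments rhs_term {F} q s L M a b m.
Arguments lhs_term {F} q L M a b j.

(* Main.v *)
(** Burge's transform, a form of the q-Saalschutz sum, writes
    q^(b^2) B(L,M,a+b,b) as a combination over i of the products
    q^(i^2) [2L+M-i; 2L] B(L-i,i,a,b). Applied for each j to (aj, bj), it
    expresses the left-hand side for (a+b, b) through the one for (a, b), or,
    since B(L,M,a,b) = B(M,L,b,a), through the one for (b, a). Running the
    subtractive Euclidean algorithm on (a, b) thus reduces everything to the
    pair (1, 1), where the sum is [L+M; L] in base q^2. Each step of the
    algorithm removes one unit from the composition given by the partial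
    quotients, that is, the first row and column of C, and contributes the
    q-binomial coefficient attached to the first summation variable. *)

Require Import Defs.
From HB Require Import structures.
From mathcomp Require Import all_boot all_order all_algebra.
From mathcomp Require Import ring zify.
(* [Defs] is imported again because MathComp shadows its [dim] and [isT]. *)
Import Defs Order.TTheory GRing.Theory Num.Theory.
Local Open Scope ring_scope.
Set Implicit Arguments. Unset Strict Implicit. Unset Printing Implicit Defensive.

(** * q-factorials and their reciprocals at integer arguments *)

Definition not_root_of_unity {F : fieldType} (q : F) : Prop :=
  q != 0 /\ forall i : nat, (0 < i)%N -> q ^+ i != 1.

(* Meaningless for [n < 0]; in [qbinE] such values are multiplied by a zero [invqfac]. *)
Definition qfacz {F : fieldType} (q : F) (n : int) : F := qfac q `|n|%N.

(** The value zero at negative [n] makes the recurrence [invqfac_pred] hold for every integer and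
    encodes the vanishing of q-binomials outside their range. *)
Definition invqfac {F : fieldType} (q : F) (n : int) : F :=
  if 0 <= n then (qfac q `|n|%N)^-1 else 0.

Lemma qfacS (F : fieldType) (q : F) (n : nat) :
  qfac q n.+1 = qfac q n * (1 - q ^+ n.+1).
Proof. by rewrite /qfac /qpoch big_ord_recr /= -exprS. Qed.

Lemma qfac_neq0 (F : fieldType) (q : F) (n : nat) :
  not_root_of_unity q -> qfac q n != 0.
Proof.
case=> _ hq; elim: n => [|n IH]; first by rewrite /qfac /qpoch big_ord0 oner_eq0.
by rewrite qfacS mulf_neq0 // subr_eq0 eq_sym hq.
Qed.

Lemma qfaczS (F : fieldType) (q : F) (n : int) :
  0 <= n -> qfacz q (n + 1) = qfacz q n * (1 - q ^ (n + 1)).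
Proof. by case: n => // n _; rewrite /qfacz -PoszD addn1 !absz_nat qfacS. Qed.

Lemma invqfac0 (F : fieldType) (q : F) : invqfac q 0 = 1.
Proof. by rewrite /invqfac /qfac /qpoch big_ord0 invr1. Qed.

Lemma invqfac_lt0 (F : fieldType) (q : F) (n : int) : n < 0 -> invqfac q n = 0.
Proof. by rewrite /invqfac leNgt => ->. Qed.

Lemma qfaczK (F : fieldType) (q : F) (n : int) :
  not_root_of_unity q -> 0 <= n -> qfacz q n * invqfac q n = 1.
Proof. by move=> hq n0; rewrite /invqfac n0 mulfV // qfac_neq0. Qed.

Lemma invqfac_pred (F : fieldType) (q : F) (n : int) :
  not_root_of_unity q -> invqfac q (n - 1) = (1 - q ^ n) * invqfac q n.
Proof.
move=> hq; have [n_lt0|n_gt0|->] := ltgtP n 0.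
- by rewrite !invqfac_lt0 ?mulr0 //; lia.
- have n1 : 0 <= n - 1 by lia.
  apply: (mulfI (x := qfacz q (n - 1))); first exact: qfac_neq0.
  rewrite qfaczK // mulrA -{2}(subrK 1 n) -qfaczS // subrK qfaczK //; lia.
- by rewrite expr0z subrr mul0r invqfac_lt0.
Qed.

Lemma qbinE (F : fieldType) (q : F) (N m : int) :
  qbin q N m = qfacz q N * invqfac q m * invqfac q (N - m).
Proof.
rewrite /qbin /qfacz /invqfac subr_ge0.
case: (0 <= m) => /=; last by rewrite mulr0 mul0r.
by case: (m <= N); rewrite ?mulr0 // invfM mulrA.
Qed.

(** * The q-Saalschutz sum *)

(** Up to normalization, the summand of the balanced terminating 3phi2 with upper parameters q^(-X),
    q^(-Y), q^(-Z) and lower parameters q^(c+1), q^(-X-Y-Z-c). *)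
Definition saalschutz_term {F : fieldType} (q : F) (X Y Z c r : nat) : F :=
  q ^+ (r * (r + c)) * qfacz q (X%:Z + Y%:Z + Z%:Z + c%:Z - r%:Z)
  * invqfac q (X%:Z - r%:Z) * invqfac q (Y%:Z - r%:Z)
  * invqfac q (Z%:Z - r%:Z) * invqfac q r * invqfac q (r%:Z + c%:Z).

(* Wilf-Zeilberger certificate for the step from [Z] to [Z + 1]. *)
Definition saalschutz_cert {F : fieldType} (q : F) (X Y Z c r : nat) : F :=
  - q ^ (Z%:Z + 1 - r%:Z) * (1 - q ^+ r) * (1 - q ^+ (r + c))
  * saalschutz_term q X Y Z.+1 c r.

(** [invqfac_pred] brings all terms to common reciprocal factorials; what remains is a rational
    identity in q and the powers q^r, q^X, q^Y, q^Z, q^c. *)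
Lemma saalschutz_telescope (F : fieldType) (q : F) (X Y Z c r : nat) :
  not_root_of_unity q -> (r <= X)%N ->
  (1 - q ^+ Z.+1) * (1 - q ^+ (Z + c).+1) * saalschutz_term q X Y Z.+1 c r
  - (1 - q ^+ (X + Z + c).+1) * (1 - q ^+ (Y + Z + c).+1) * saalschutz_term q X Y Z c r
  = saalschutz_cert q X Y Z c r.+1 - saalschutz_cert q X Y Z c r.
Proof.
move=> hq rX; have q0 := hq.1.
rewrite /saalschutz_cert /saalschutz_term.
set N := X%:Z + Y%:Z + Z%:Z + c%:Z - r%:Z.
have -> : X%:Z + Y%:Z + Z.+1%:Z + c%:Z - r%:Z = N + 1 by rewrite /N; lia.
have -> : X%:Z + Y%:Z + Z.+1%:Z + c%:Z - r.+1%:Z = N by rewrite /N; lia.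
(* Here [r <= X] is what makes [N] nonnegative. *)
rewrite qfaczS; last by rewrite /N; lia.
have -> : X%:Z - r.+1%:Z = X%:Z - r%:Z - 1 by lia.
have -> : Y%:Z - r.+1%:Z = Y%:Z - r%:Z - 1 by lia.
have -> : Z.+1%:Z - r.+1%:Z = Z.+1%:Z - r%:Z - 1 by lia.
have -> : Z%:Z - r%:Z = Z.+1%:Z - r%:Z - 1 by lia.
have E1 : invqfac q r = (1 - q ^ r.+1%:Z) * invqfac q r.+1.
  by rewrite -invqfac_pred //; congr invqfac; lia.
have E2 : invqfac q (r%:Z + c%:Z) = (1 - q ^ (r.+1%:Z + c%:Z)) * invqfac q (r.+1%:Z + c%:Z).
  by rewrite -invqfac_pred //; congr invqfac; lia.
rewrite E1 E2 !invqfac_pred //.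
set A := invqfac q (X%:Z - _); set B := invqfac q (Y%:Z - _).
set C := invqfac q (Z.+1%:Z - _); set D := invqfac q r.+1.
set E := invqfac q (_ + _); set G := qfacz q N.
have -> : (r.+1 * (r.+1 + c) = r * (r + c) + r + r + c + 1)%N by lia.
rewrite /N !addSn !exprS !exprD !(expfzDr _ _ q0) -!exprnN -!exprnP !expr1 ?exprS.
set w := q ^+ (r * (r + c)).
have := expf_neq0 r q0; set t := q ^+ r.
set x := q ^+ X; set y := q ^+ Y; set z := q ^+ Z; set k := q ^+ c => t0.
by field; rewrite ?q0 ?t0.
Qed.

Lemma subr1X_neq0 (F : fieldType) (q : F) (n : nat) :
  not_root_of_unity q -> (0 < n)%N -> 1 - q ^+ n != 0.
Proof. by move=> hq n0; rewrite subr_eq0 eq_sym hq.2. Qed.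

Lemma invqfac_nat (F : fieldType) (q : F) (n : nat) :
  invqfac q n = (qfacz q n)^-1.
Proof. by []. Qed.

(** Induction on [Z]: both sides satisfy the same first-order recurrence, and at Z = 0 only r = 0
    survives. *)
Lemma q_saalschutz (F : fieldType) (q : F) (X Y Z c : nat) :
  not_root_of_unity q ->
  \sum_(0 <= r < X.+1) saalschutz_term q X Y Z c r =
  qfac q (X + Y + c) * qfac q (X + Z + c) * qfac q (Y + Z + c) /
  (qfac q X * qfac q Y * qfac q Z
   * qfac q (X + c) * qfac q (Y + c) * qfac q (Z + c)).
Proof.
move=> hq; have nz n := qfac_neq0 n hq; have q0 := hq.1.
elim: Z => [|Z IH].
  rewrite big_nat_recl // big1 => [|r _]; last first.
    by rewrite /saalschutz_term [invqfac q (0%:Z - _)]invqfac_lt0 ?mulr0 ?mul0r //; lia.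
  rewrite /saalschutz_term mul0n !subr0 !addr0 add0r !addn0 -!PoszD
    !invqfac_nat /qfacz !absz_nat expr0 !add0n.
  have -> : qfac q 0 = 1 by rewrite /qfac /qpoch big_ord0.
  by field; rewrite !nz oner_eq0.
have D0 : (1 - q ^+ Z.+1) * (1 - q ^+ (Z + c).+1) != 0.
  by rewrite mulf_neq0 // subr1X_neq0.
apply: (mulfI D0).
(* The certificate vanishes at both ends: at 0 through 1 - q^0, at X + 1 through the reciprocal
   factorial of -1. *)
have := telescope_sumr (saalschutz_cert q X Y Z c) (leq0n X.+1).
rewrite [saalschutz_cert _ _ _ _ _ 0]/saalschutz_cert expr0 subrr mulr0 !mul0r subr0.
rewrite [saalschutz_cert _ _ _ _ _ X.+1]/saalschutz_cert /saalschutz_term.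
rewrite [invqfac q (X%:Z - _)]invqfac_lt0 ?(mulr0, mul0r); last by lia.
rewrite big_nat; under eq_bigr => r rX do rewrite -saalschutz_telescope //.
rewrite -big_nat sumrB -!mulr_sumr IH => /eqP; rewrite subr_eq0 => /eqP ->.
rewrite !addnS !addSn !qfacS.
have h n := subr1X_neq0 hq (ltn0Sn n).
by field; rewrite ?nz ?h ?oner_eq0.
Qed.

(** * Burge's transform *)

Lemma Bfun_opp (F : fieldType) (q : F) (L M a b : int) :
  Bfun q L M (- a) (- b) = Bfun q L M a b.
Proof. by rewrite /Bfun mulrC !opprK. Qed.

(** In terms of factorials the four denominators have arguments L + a, L - a, M + b, M - b, and the
    exchange only permutes them. *)
Lemma Bfun_sym (F : fieldType) (q : F) (L M a b : int) :
  Bfun q L M a b = Bfun q M L b a.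
Proof.
rewrite /Bfun !qbinE mulrC.
have -> : L + M - a + b - (L - a) = M + b by ring.
have -> : L + M + a - b - (L + a) = M - b by ring.
have -> : M + L + b - a - (M + b) = L - a by ring.
have -> : M + L - b + a - (M - b) = L + a by ring.
have -> : L + M - a + b = M + L + b - a by ring.
have -> : L + M + a - b = M + L - b + a by ring.
by ring.
Qed.

Lemma qbin_small (F : fieldType) (q : F) (N m : int) : N < m -> qbin q N m = 0.
Proof. by rewrite /qbin ltNge => /negbTE ->; rewrite andbF. Qed.

Lemma Bfun_M_small (F : fieldType) (q : F) (L M a b : int) :
  M < `|b| -> Bfun q L M a b = 0.
Proof.
move=> h; rewrite /Bfun; have [hb|hb] := leP 0 b.
  by rewrite qbin_small ?mul0r //; lia.
by rewrite [qbin q (L + M - a + b) _]qbin_small ?mulr0 //; lia.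
Qed.

Lemma Bfun_L_small (F : fieldType) (q : F) (L M a b : int) :
  L < `|a| -> Bfun q L M a b = 0.
Proof. by move=> h; rewrite Bfun_sym Bfun_M_small. Qed.

(* The summand with index [b + r] is, up to a common factor, the [r]-th term of
   the q-Saalschutz sum. *)
Lemma burge_nat (F : fieldType) (q : F) (L : nat) (M : int) (a b : nat) :
  not_root_of_unity q ->
  q ^+ (b ^ 2) * Bfun q L M (a + b)%:Z b =
  \sum_(0 <= i < L.+1)
    q ^+ (i ^ 2) * qbin q (2 * L%:Z + M - i%:Z) (2 * L%:Z)
    * Bfun q (L%:Z - i%:Z) i a b.
Proof.
move=> hq; have nz n := qfac_neq0 n hq; have q0 := hq.1.
(* Unless b <= M and a + b <= L both sides vanish, the right one term by term. *)
have [hM|hM] := ltP M b%:Z.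
  rewrite Bfun_M_small ?mulr0; last by lia.
  rewrite big1 // => i _; have [ib|bi] := ltnP i b.
    by rewrite Bfun_M_small ?mulr0 //; lia.
  by rewrite qbin_small ?mulr0 ?mul0r //; lia.
have [hL|hL] := ltnP L (a + b).
  rewrite Bfun_L_small ?mulr0; last by lia.
  rewrite big1 // => i _; have [ib|bi] := ltnP i b.
    by rewrite Bfun_M_small ?mulr0 //; lia.
  by rewrite Bfun_L_small ?mulr0 //; lia.
case: M hM => // M hM.
pose X := (L - b - a)%N; pose Y := (L - b + a)%N; pose Z := (M - b)%N.
have EL : L = (X + a + b)%N by rewrite /X; lia.
have EM : M = (Z + b)%N by rewrite /Z; lia.
have EY : Y = (X + a + a)%N by rewrite /X /Y; lia.
(* Only b <= i <= L - a contributes, that is, i = b + r with 0 <= r <= X. *)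
rewrite (big_cat_nat _ (n := b)) //=; last by lia.
rewrite big_nat big1 ?add0r => [|i /andP[_ ib]]; last first.
  by rewrite Bfun_M_small ?mulr0 //; lia.
rewrite (big_cat_nat _ (n := (b + X.+1)%N)) //=; [|lia|lia].
rewrite [W in _ + W]big_nat [W in _ + W]big1 ?addr0 => [|i /andP[bi iL]]; last first.
  by rewrite Bfun_L_small ?mulr0 //; lia.
rewrite -[W in \sum_(W <= _ < _) _]add0n big_addn addKn.
pose K : F := q ^+ (b ^ 2) * qfac q Y * qfac q (X + b.*2) / qfac q L.*2.
transitivity (K * \sum_(0 <= r < X.+1) saalschutz_term q X Y Z b.*2 r); last first.
  rewrite mulr_sumr; apply: eq_big_nat => r rX.
  have -> : ((r + b) ^ 2 = b ^ 2 + r * (r + b.*2))%N by rewrite -muln2; ring.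
  rewrite /Bfun !qbinE /saalschutz_term exprD.
  have -> : 2 * L%:Z + M%:Z - (r + b)%N%:Z = X%:Z + Y%:Z + Z%:Z + b.*2%:Z - r%:Z by lia.
  have -> : X%:Z + Y%:Z + Z%:Z + b.*2%:Z - r%:Z - 2 * L%:Z = Z%:Z - r%:Z by lia.
  have -> : L%:Z - (r + b)%N%:Z + a%:Z = Y%:Z - r%:Z by lia.
  have -> : L%:Z - (r + b)%N%:Z - a%:Z = X%:Z - r%:Z by lia.
  have -> : L%:Z - (r + b)%N%:Z + (r + b)%N%:Z + a%:Z - b%:Z = Y by lia.
  have -> : L%:Z - (r + b)%N%:Z + (r + b)%N%:Z - a%:Z + b%:Z = (X + b.*2)%N by lia.
  have -> : Y%:Z - (Y%:Z - r%:Z) = r by lia.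
  have -> : (X + b.*2)%N%:Z - (X%:Z - r%:Z) = r%:Z + b.*2%:Z by lia.
  have -> : 2 * L%:Z = L.*2 by lia.
  by rewrite !invqfac_nat /qfacz !absz_nat /K; ring.
rewrite q_saalschutz // /Bfun !qbinE.
have -> : L%:Z + M%:Z + (a + b)%N%:Z - b%:Z = (Y + Z + b.*2)%N by lia.
have -> : L%:Z + M%:Z - (a + b)%N%:Z + b%:Z = (X + Z + b.*2)%N by lia.
have -> : L%:Z + (a + b)%N%:Z = (Y + b.*2)%N by lia.
have -> : L%:Z - (a + b)%N%:Z = X by lia.
have -> : (Y + Z + b.*2)%N%:Z - (Y + b.*2)%N%:Z = Z by lia.
have -> : (X + Z + b.*2)%N%:Z - X%:Z = (Z + b.*2)%N by lia.
have E : (X + Y + b.*2 = L.*2)%N by lia.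
rewrite !invqfac_nat /qfacz !absz_nat /K E.
by field; rewrite !nz.
Qed.

(** Both sides are even in [j] by [Bfun_opp], so [burge_nat] at (aj, bj) with j >= 0 suffices. *)
Lemma burge (F : fieldType) (q : F) (L : nat) (M : int) (a b : nat) (j : int) :
  not_root_of_unity q ->
  q ^ (b%:Z ^+ 2 * j ^+ 2) * Bfun q L M ((a + b)%:Z * j) (b%:Z * j) =
  \sum_(0 <= i < L.+1)
    q ^+ (i ^ 2) * qbin q (2 * L%:Z + M - i%:Z) (2 * L%:Z)
    * Bfun q (L%:Z - i%:Z) i (a%:Z * j) (b%:Z * j).
Proof.
move=> hq; wlog [k ->] : j / exists k : nat, j = k.
  move=> H; have [j0|j0] := leP 0 j; first by apply: H; exists `|j|%N; lia.
  have := H (- j); rewrite sqrrN !mulrN Bfun_opp => -> //.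
    by apply: eq_bigr => i _; rewrite Bfun_opp.
  by exists `|j|%N; lia.
have := burge_nat L M (a * k) (b * k) hq.
rewrite -mulnDl !PoszM => <-; congr (_ * _).
by rewrite (exprnP q); congr (q ^ _); lia.
Qed.

(** * The seed sum for the pair (1, 1) *)

(* With [N = L + M], these sum to a multiple of the coefficient of z^(2L) in
   (z;q)_N (-z;q)_N = (z^2;q^2)_N. *)
Definition seed_term {F : fieldType} (q : F) (L N : int) (j : int) : F :=
  (-1) ^ j * q ^ (j ^+ 2) * (invqfac q (L + j) * invqfac q (L - j) *
   (invqfac q (N - L - j) * invqfac q (N - L + j))).

(** Telescoping certificate for the step from [N - 1] to [N]. *)
Definition seed_cert {F : fieldType} (q : F) (L N : int) (j : int) : F :=
  - (1 - q ^ N) * q ^ (N - L - j) * (1 - q ^ (L + j)) * (1 - q ^ (N - L + j))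
  * seed_term q L N j.

Lemma seed_telescope (F : fieldType) (q : F) (L N j : int) :
  not_root_of_unity q ->
  (1 - q ^ (2 * (N - L))) * (1 - q ^ N) ^+ 2 * seed_term q L N j
  - (1 - q ^ (2 * N)) * seed_term q L (N - 1) j
  = seed_cert q L N (j + 1) - seed_cert q L N j.
Proof.
move=> hq; have q0 := hq.1.
rewrite /seed_cert /seed_term.
have -> : N - 1 - L - j = N - L - j - 1 by ring.
have -> : N - 1 - L + j = N - L + j - 1 by ring.
have -> : L - (j + 1) = L - j - 1 by ring.
have -> : N - L - (j + 1) = N - L - j - 1 by ring.
have -> : L + j = L + (j + 1) - 1 by ring.
have -> : N - L + j = N - L + (j + 1) - 1 by ring.
rewrite !invqfac_pred //.
set A := invqfac q (L - j); set B := invqfac q (N - L - j).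
set C := invqfac q (L + (j + 1)); set D := invqfac q (N - L + (j + 1)).
have e1 : (j + 1) ^+ 2 = j ^+ 2 + j + j + 1 by ring.
have e2 : (-1 : F) ^ (j + 1) = - (-1) ^ j by rewrite expfzDr ?oppr_eq0 ?oner_eq0 // mulrN1.
have e3 (x : int) : q ^ (2 * x) = q ^ x * q ^ x by rewrite -expfzDr // mulr2n mulrDl mul1r.
rewrite e1 e2 !e3 !(expfzDr _ _ q0) -!invr_expz !expr1z.
have := expfz_neq0 j q0; have := expfz_neq0 L q0.
set t := q ^ j; set l := q ^ L; set n := q ^ N => l0 t0.
by field; rewrite ?q0 ?l0 ?t0.
Qed.

Lemma not_root_of_unity_sqr (F : fieldType) (q : F) :
  not_root_of_unity q -> not_root_of_unity (q ^+ 2).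
Proof.
case=> q0 hq; split=> [|i i0]; first by rewrite expf_neq0.
by rewrite -exprM hq // muln_gt0.
Qed.

(** Induction on [M] by the telescoped recurrence; at M = 0 only j = 0 survives. Since L <= K, the
    window contains the support |j| <= L. *)
Lemma sum_seed_term (F : fieldType) (q : F) (K L M : nat) :
  not_root_of_unity q -> (L <= K)%N ->
  \sum_(0 <= i < K.*2.+1) seed_term q L (L + M)%N (i%:Z - K%:Z) =
  qfac (q ^+ 2) (L + M) / (qfac (q ^+ 2) L * qfac (q ^+ 2) M * qfac q (L + M) ^+ 2).
Proof.
move=> hq LK; have nz n := qfac_neq0 n hq; have q0 := hq.1.
have nz2 n := qfac_neq0 n (not_root_of_unity_sqr hq).
elim: M => [|M IH].
  rewrite (bigD1_seq K) ?iota_uniq ?mem_index_iota //=; last by lia.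
  rewrite big1 ?addr0 => [|i iK].
    rewrite /seed_term subrr addn0 ?addr0 ?subr0 ?subrr invqfac0 invqfac_nat expr0z.
    rewrite (_ : qfac _ 0 = 1) /qfacz ?absz_nat; last by rewrite /qfac /qpoch big_ord0.
    by rewrite expr0n /= expr0z; field; rewrite ?nz ?nz2 ?oner_eq0.
  rewrite /seed_term addn0; have [lt|ge] := ltnP i K.
    by rewrite (@invqfac_lt0 _ _ (L%:Z - L%:Z + (i%:Z - K%:Z))) ?mulr0 //; lia.
  by rewrite (@invqfac_lt0 _ _ (L%:Z - L%:Z - (i%:Z - K%:Z))) ?(mul0r, mulr0) //; lia.
have h n := subr1X_neq0 hq (ltn0Sn n).
have h2 n := subr1X_neq0 (not_root_of_unity_sqr hq) (ltn0Sn n).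
have D0 : (1 - (q ^+ 2) ^+ M.+1) * (1 - q ^+ (L + M).+1) ^+ 2 != 0.
  by rewrite mulf_neq0 // expf_neq0.
apply: (mulfI D0).
pose g (i : nat) := seed_cert q L (L + M).+1 (i%:Z - K%:Z).
have := telescope_sumr g (leq0n K.*2.+1).
(* At j = -K the polynomial factor vanishes if L = K and the reciprocal factorial if L < K; their
   product is [invqfac] at L - K - 1 < 0 in both cases. *)
have -> : g 0%N = 0.
  have pr : (1 - q ^ (L%:Z + (0%:Z - K%:Z))) * invqfac q (L%:Z + (0%:Z - K%:Z)) = 0.
    by rewrite -invqfac_pred // invqfac_lt0 //; lia.
  rewrite /g /seed_cert /seed_term.
  set A := 1 - q ^ (L%:Z + _) in pr *; set B := invqfac q (L%:Z + _) in pr *.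
  have [/eqP A0|/eqP B0] : A == 0 \/ B == 0 by apply/orP; rewrite -mulf_eq0 pr.
    by rewrite A0 !(mulr0, mul0r).
  by rewrite B0 !(mulr0, mul0r).
rewrite subr0.
have -> : g K.*2.+1 = 0.
  rewrite /g /seed_cert /seed_term [invqfac q (L%:Z - _)]invqfac_lt0 ?(mul0r, mulr0) //; lia.
move=> E.
have {E} : \sum_(0 <= i < K.*2.+1)
   ((1 - (q ^+ 2) ^+ M.+1) * (1 - q ^+ (L + M).+1) ^+ 2
     * seed_term q L (L + M).+1 (i%:Z - K%:Z)
    - (1 - (q ^+ 2) ^+ (L + M).+1) * seed_term q L (L + M)%N (i%:Z - K%:Z)) = 0.
  rewrite -[RHS]E; apply: eq_bigr => i _; rewrite /g.
  have -> : i.+1%:Z - K%:Z = i%:Z - K%:Z + 1 by lia.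
  rewrite -seed_telescope // -!exprM !exprnP; congr (_ - _).
    by congr ((1 - q ^ _) * _ * _); lia.
  by congr ((1 - q ^ _) * seed_term q L _ _); lia.
rewrite sumrB -!mulr_sumr addnS => /eqP; rewrite subr_eq0 => /eqP ->.
rewrite IH !qfacS.
by field; rewrite ?nz ?nz2 ?h ?h2.
Qed.

(** * The truncated left-hand side and its recurrences *)

(* The sum is over [-K <= j <= K]; Burge's transform acts on each [j] separately,
   so only the seed [boson11] needs [K] large. *)
Definition boson {F : fieldType} (q : F) (K : nat) (L M : int) (a b : nat) : F :=
  \sum_(0 <= i < K.*2.+1)
    let j := i%:Z - K%:Z in
    (-1) ^ j * q ^ (a%:Z * b%:Z * j ^+ 2) * Bfun q L M (a%:Z * j) (b%:Z * j).

Lemma boson_sym (F : fieldType) (q : F) (K : nat) (L M : int) (a b : nat) :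
  boson q K L M a b = boson q K M L b a.
Proof. by apply: eq_bigr => i _ /=; rewrite Bfun_sym [a%:Z * b%:Z]mulrC. Qed.

Lemma boson_M_lt0 (F : fieldType) (q : F) (K : nat) (L M : int) (a b : nat) :
  M < 0 -> boson q K L M a b = 0.
Proof.
move=> M0; rewrite /boson big1 // => i _ /=.
by rewrite Bfun_M_small ?mulr0 //; apply: (lt_le_trans M0).
Qed.

(** For a = b = 1 both numerators of [Bfun] are (q)_(L+M), independent of [j], and factoring them
    out leaves the seed sum. *)
Lemma boson11 (F : fieldType) (q : F) (K L : nat) (M : int) :
  not_root_of_unity q -> (L <= K)%N ->
  boson q K L M 1 1 = qbin (q ^+ 2) (L%:Z + M) L.
Proof.
move=> hq LK; have [M0|] := ltP M 0; first by rewrite boson_M_lt0 // qbin_small //; lia.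
case: M => // M _; have nz n := qfac_neq0 n hq.
rewrite qbinE -PoszD (_ : (L + M)%N%:Z - L%:Z = M); last by lia.
rewrite !invqfac_nat /qfacz !absz_nat.
transitivity (qfac q (L + M) ^+ 2 *
    \sum_(0 <= i < K.*2.+1) seed_term q L (L + M)%N (i%:Z - K%:Z)); last first.
  by rewrite sum_seed_term //; field; rewrite ?nz ?(qfac_neq0 _ (not_root_of_unity_sqr hq)).
rewrite mulr_sumr; apply: eq_bigr => i _ /=.
set j := _ - _; rewrite !mul1r /Bfun !qbinE /seed_term.
have -> : L%:Z + M%:Z + j - j = (L + M)%N by lia.
have -> : L%:Z + M%:Z - j + j = (L + M)%N by lia.
have -> : (L + M)%N%:Z - (L%:Z + j) = (L + M)%N%:Z - L%:Z - j by lia.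
have -> : (L + M)%N%:Z - (L%:Z - j) = (L + M)%N%:Z - L%:Z + j by lia.
by rewrite /qfacz absz_nat; ring.
Qed.

(** The exponent splits as (a+b)bj^2 = abj^2 + b^2j^2: the second part is absorbed by Burge's
    transform, the first is the weight for (a, b). *)
Lemma boson_burge (F : fieldType) (q : F) (K L : nat) (M : int) (a b : nat) :
  not_root_of_unity q ->
  boson q K L M (a + b) b =
  \sum_(0 <= i < L.+1)
    q ^+ (i ^ 2) * qbin q (2 * L%:Z + M - i%:Z) (2 * L%:Z)
    * boson q K (L%:Z - i%:Z) i a b.
Proof.
move=> hq; have q0 := hq.1; rewrite /boson.
under [RHS]eq_bigr => i _ do rewrite mulr_sumr.
rewrite exchange_big /=; apply: eq_bigr => k _; set j := _ - _.
have -> : (a + b)%:Z * b%:Z * j ^+ 2 = a%:Z * b%:Z * j ^+ 2 + b%:Z ^+ 2 * j ^+ 2.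
  by rewrite PoszD; ring.
rewrite (expfzDr _ _ q0) mulrA -[LHS]mulrA burge // mulr_sumr.
by apply: eq_bigr => i _; ring.
Qed.

Lemma boson_burge_swap (F : fieldType) (q : F) (K L : nat) (M : int) (a b : nat) :
  not_root_of_unity q ->
  boson q K L M (a + b) b =
  \sum_(0 <= i < L.+1)
    q ^+ (i ^ 2) * qbin q (2 * L%:Z + M - i%:Z) (2 * L%:Z)
    * boson q K i (L%:Z - i%:Z) b a.
Proof.
by move=> hq; rewrite boson_burge //; apply: eq_bigr => i _; rewrite boson_sym.
Qed.

(** As in [boson_burge_swap], the summation index becomes the first argument of the inner sum, the
    shape needed for iteration; here the order of (a, b) is kept. *)
Lemma boson_burge_rev (F : fieldType) (q : F) (K L : nat) (M : int) (a b : nat) :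
  not_root_of_unity q ->
  boson q K L M (a + b) b =
  \sum_(0 <= i < L.+1)
    q ^ ((L%:Z - i%:Z) ^+ 2) * qbin q (L%:Z + M + i%:Z) (2 * L%:Z)
    * boson q K i (L%:Z - i%:Z) a b.
Proof.
move=> hq; rewrite boson_burge // big_nat_rev /= !big_nat.
apply: eq_bigr => i /andP[_ iL]; rewrite add0n subSS (exprnP q).
congr (q ^ _ * qbin q _ _ * boson q K _ _ a b); try lia.
by rewrite -mulnn PoszM expr2 subzn.
Qed.

(** * Splitting the first variable off the fermionic summand *)

Definition fermi {F : fieldType} (q : F) (s : seq nat) (L : nat) (m : seq nat) : F :=
  q ^ (mCm s m) * \prod_(1 <= j < (dim s).+1)
    qbin (q ^+ (3 - tau s j)) ((tau s j)%:Z * mj m j + nvec s L m j)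
         ((tau s j)%:Z * mj m j).

(* [t] is the composition [s] with its first unit removed, so that [Cmat t] is
   [Cmat s] without its first row and column. *)
Definition peels (s t : seq nat) : Prop :=
  [/\ dim s = (dim t).+1, (0 < dim t)%N &
      forall j, (0 < j)%N -> isT s j.+1 = isT t j].

Lemma isTE (s : seq nat) (j : nat) :
  isT s j = has (fun i => tpos s i.+1 == j) (iota 0 (size s)).
Proof. by rewrite /isT (iotaDl 1 0) has_map. Qed.

Lemma peels_SS (x : nat) (t : seq nat) : peels (x.+2 :: t) (x.+1 :: t).
Proof.
split; rewrite ?/dim /=; [by rewrite addSn|by []|] => j j0; rewrite !isTE; apply: eq_has => i.
by rewrite /tpos /= addSn eqSS.
Qed.

Lemma peels_1 (x : nat) (t : seq nat) : (0 < x)%N -> peels [:: 1%N, x & t] (x :: t).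
Proof.
move=> x0; split; rewrite ?/dim /= ?addn_gt0 ?x0 //.
move=> j j0; rewrite !isTE -[size [:: 1%N, x & t]]/(size (x :: t)).+1.
move: (size _) => k; rewrite [iota 0 k.+1]/= (iotaDl 1 0) [LHS]/= has_map.
by rewrite {1}/tpos /= addn0 eqSS eq_sym (gtn_eqF j0).
Qed.

Lemma isT_SS1 (x : nat) (t : seq nat) : isT (x.+2 :: t) 1 = false.
Proof. by rewrite isTE; apply/hasP => -[i _]; rewrite /tpos /= addSn. Qed.

Lemma isT_1 (t : seq nat) : isT (1%N :: t) 1.
Proof. by rewrite isTE /= /tpos /= take0. Qed.

Lemma big_nat1_recl (R : Type) (idx : R) (op : R -> R -> R) (n : nat) (f : nat -> R) :
  \big[op/idx]_(1 <= j < n.+2) f j = op (f 1%N) (\big[op/idx]_(1 <= j < n.+1) f j.+1).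
Proof. by rewrite big_ltn // big_add1. Qed.

Lemma sum_nat1_first (V : zmodType) (n : nat) (f : nat -> V) :
  (0 < n)%N -> (forall k, (1 < k)%N -> f k = 0) -> \sum_(1 <= k < n.+1) f k = f 1%N.
Proof.
move=> n0 f0; rewrite big_ltn // big_nat big1 ?addr0 // => k /andP[k1 _].
exact: f0.
Qed.

Lemma Cmat_peel (s t : seq nat) (j k : nat) :
  peels s t -> (0 < j)%N -> Cmat s j.+1 k.+1 = Cmat t j k.
Proof. by case=> _ _ h j0; rewrite /Cmat /Imat h. Qed.

Lemma Cmat_col1 (s : seq nat) (j : nat) : (0 < j)%N -> Cmat s j.+1 1 = - (j == 1%N)%:Z.
Proof. by case: j => // j _; rewrite /Cmat /Imat; case: ifP; case: j. Qed.

Lemma Cmat_row1 (s : seq nat) (k : nat) : (1 < k)%N -> Cmat s 1 k.+1 = 0.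
Proof. by case: k => // -[] // k _; rewrite /Cmat /Imat; case: ifP. Qed.

Lemma mjS (m1 : nat) (m : seq nat) (j : nat) : (0 < j)%N -> mj (m1 :: m) j.+1 = mj m j.
Proof. by case: j. Qed.

(** The first row and column of C vanish beyond the second entry and C_21 = -1, so m_1 meets only
    m_2, with coefficient C_12 - 1. *)
Lemma mCm_peel (s t : seq nat) (m1 : nat) (m : seq nat) :
  peels s t ->
  mCm s (m1 :: m) =
  Cmat s 1 1 * m1%:Z ^+ 2 + (Cmat s 1 2 - 1) * m1%:Z * mj m 1 + mCm t m.
Proof.
move=> st; have [ds dt _] := st; rewrite /mCm ds !big_nat1_recl.
rewrite (@sum_nat1_first _ _ (fun k => _ * Cmat s 1 k.+1 * _)) //; last first.
  by move=> k k1; rewrite Cmat_row1 // mulr0 mul0r.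
have -> : \sum_(1 <= j < (dim t).+1) \sum_(1 <= k < (dim t).+2)
     mj (m1 :: m) j.+1 * Cmat s j.+1 k * mj (m1 :: m) k =
  \sum_(1 <= j < (dim t).+1) (- (j == 1%N)%:Z * (m1%:Z * mj m j)
    + \sum_(1 <= k < (dim t).+1) mj m j * Cmat t j k * mj m k).
  rewrite !big_nat; apply: eq_bigr => j /andP[j0 _]; rewrite big_nat1_recl.
  rewrite Cmat_col1 // mjS //; congr (_ + _); first by rewrite /mj /=; ring.
  rewrite !big_nat; apply: eq_bigr => k /andP[k0 _].
  by rewrite (Cmat_peel _ st) // mjS.
rewrite big_split /= (@sum_nat1_first _ _ (fun j => - (j == 1%N)%:Z * _)) //; last first.
  by case=> [|[]].
by rewrite /mj /=; ring.
Qed.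

(** The entry C_21 = -1 contributes m_1 to the second component, so m_1 takes over the role of [L]
    in the smaller system. *)
Lemma nvec_peel (s t : seq nat) (L m1 : nat) (m : seq nat) (j : nat) :
  peels s t -> (0 < j)%N -> nvec s L (m1 :: m) j.+1 = nvec t m1 m j.
Proof.
move=> st j0; have [ds dt _] := st; rewrite /nvec ds big_nat1_recl Cmat_col1 //.
rewrite eqSS (gtn_eqF j0) mulr0 sub0r opprD mulNr opprK mulrC; congr (_ - _).
by rewrite !big_nat; apply: eq_bigr => k /andP[k0 _]; rewrite (Cmat_peel _ st) // mjS.
Qed.

Lemma nvec_peel1 (s t : seq nat) (L m1 : nat) (m : seq nat) :
  peels s t ->
  nvec s L (m1 :: m) 1 = L%:Z - Cmat s 1 1 * m1%:Z - Cmat s 1 2 * mj m 1.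
Proof.
move=> st; have [ds dt _] := st; rewrite /nvec ds big_nat1_recl mulr1.
rewrite (@sum_nat1_first _ _ (fun k => Cmat s 1 k.+1 * _)) //; last first.
  by move=> k k1; rewrite Cmat_row1 // mul0r.
by rewrite /mj /=; ring.
Qed.

Lemma fermi_peel (F : fieldType) (q : F) (s t : seq nat) (L m1 : nat) (m : seq nat) :
  q != 0 -> peels s t ->
  fermi q s L (m1 :: m) =
  q ^ (Cmat s 1 1 * m1%:Z ^+ 2 + (Cmat s 1 2 - 1) * m1%:Z * mj m 1)
  * qbin q (2 * m1%:Z + (L%:Z - Cmat s 1 1 * m1%:Z - Cmat s 1 2 * mj m 1)) (2 * m1%:Z)
  * fermi q t m1 m.
Proof.
move=> q0 st; have [ds dt _] := st; rewrite /fermi (mCm_peel _ _ st) expfzDr // ds big_nat1_recl.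
rewrite (nvec_peel1 _ _ _ st).
have -> : tau s 1 = 2%N by rewrite /tau ds ltnS dt.
rewrite expr1 [mj (m1 :: m) 1]/mj /=.
rewrite -!mulrA; congr (_ * _); rewrite mulrCA; congr (_ * (_ * _)).
rewrite !big_nat; apply: eq_bigr => j /andP[j0 _].
by rewrite mjS // (nvec_peel _ _ _ st) // /tau ds ltnS.
Qed.

(** Here C_11 = 2 and C_12 = -1. The q-binomial is the one in [boson_burge_rev] at (m1, L - m1). *)
Lemma fermi_SS (F : fieldType) (q : F) (x : nat) (t : seq nat) (L m1 m2 : nat) (m : seq nat) :
  q != 0 ->
  fermi q (x.+2 :: t) L [:: m1, m2 & m] =
  q ^ (2 * m1%:Z ^+ 2 - 2 * m1%:Z * m2%:Z) * qbin q (L%:Z + m2%:Z) (2 * m1%:Z)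
  * fermi q (x.+1 :: t) m1 (m2 :: m).
Proof.
move=> q0; rewrite (fermi_peel _ _ _ q0 (peels_SS x t)) /Cmat /Imat isT_SS1 /= /mj /=.
congr (q ^ _ * qbin q _ _ * _); ring.
Qed.

(** Here C_11 = C_12 = 1, so the cross term cancels. The q-binomial is the one in [boson_burge_swap]
    at (m1, L - m1). *)
Lemma fermi_1 (F : fieldType) (q : F) (x : nat) (t : seq nat) (L m1 m2 : nat) (m : seq nat) :
  q != 0 -> (0 < x)%N ->
  fermi q [:: 1%N, x & t] L [:: m1, m2 & m] =
  q ^ (m1%:Z ^+ 2) * qbin q (L%:Z + m1%:Z - m2%:Z) (2 * m1%:Z)
  * fermi q (x :: t) m1 (m2 :: m).
Proof.
move=> q0 x0; rewrite (fermi_peel _ _ _ q0 (peels_1 t x0)) /Cmat /Imat isT_1 /= /mj /=.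
congr (q ^ _ * qbin q _ _ * _); ring.
Qed.

(** The single index has tau = 1, whence the base q^2, matching [boson11] at (m1, L - m1). *)
Lemma fermi_base (F : fieldType) (q : F) (L m1 : nat) :
  fermi q [:: 1%N] L [:: m1] = q ^ (m1%:Z ^+ 2) * qbin (q ^+ 2) L m1.
Proof.
rewrite /fermi /mCm /nvec /dim /= !big_nat1 /Cmat /Imat isT_1 /tau /dim /= /mj /=.
by congr (q ^ _ * qbin _ _ _); ring.
Qed.

(** * Sums over finite boxes *)

(** The summand takes plain sequences, so that the first coordinate can be split off without casts
    between tuple types. *)
Definition boxsum {V : zmodType} (N n : nat) (f : seq nat -> V) : V :=
  \sum_(t : n.-tuple 'I_N.+1) f (map val t).

Lemma boxsum0 (V : zmodType) (N : nat) (f : seq nat -> V) : boxsum N 0 f = f [::].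
Proof.
rewrite /boxsum (bigD1 [tuple]) //= big1 ?addr0 // => t /eqP[].
exact: tuple0.
Qed.

Lemma boxsumS (V : zmodType) (N n : nat) (f : seq nat -> V) :
  boxsum N n.+1 f = \sum_(0 <= i < N.+1) boxsum N n (fun m => f (i :: m)).
Proof.
rewrite big_mkord pair_big /boxsum /=.
rewrite (reindex (fun p : 'I_N.+1 * n.-tuple 'I_N.+1 => [tuple of p.1 :: p.2])) /=.
  by [].
exists (fun t => (thead t, [tuple of behead t])) => [[x t] _|t _] /=.
  by congr pair; apply: val_inj.
by apply: val_inj; rewrite /= {3}(tuple_eta t).
Qed.

Lemma has_fsum_box (V : zmodType) (N n : nat) (f : seq nat -> V) :
  (forall m : n.-tuple nat, f m != 0 -> all (fun k => k <= N)%N m) ->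
  has_fsum (fun m : n.-tuple nat => f m) (boxsum N n f).
Proof.
move=> supp; exists [seq [tuple of map val t] | t : n.-tuple 'I_N.+1]; split.
- rewrite map_inj_uniq ?enum_uniq // => t u /(congr1 val) /= tu.
  by apply: val_inj; apply: (inj_map val_inj).
- move=> m; apply: contraNeq => /supp /allP mN.
  apply/mapP; exists [tuple of map (fun k => inord k) m]; first by rewrite mem_enum.
  apply: val_inj; rewrite /= -map_comp -[LHS]map_id; apply/eq_in_map => k km.
  by rewrite /= inordK // ltnS mN.
- by rewrite big_map big_enum.
Qed.

(** * The Euclidean algorithm on continued fractions and the main induction *)

(** Removing one unit either lowers the first part or deletes a first part equal to 1: these are the
    subtractive Euclidean steps. *)
Lemma composition_ind (P : seq nat -> Prop) :
  P [:: 1%N] ->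
  (forall x t, P (x.+1 :: t) -> P (x.+2 :: t)) ->
  (forall x t, P (x.+1 :: t) -> P [:: 1%N, x.+1 & t]) ->
  forall s, s != [::] -> all (fun x => 0 < x)%N s -> P s.
Proof.
move=> P1 PS Pc [//|x t] _; elim: t x => [|y t IH] [//|x] /= h.
  by elim: x {h} => // x IH; apply: PS.
case: y IH h => [|y] IH h //.
by elim: x => [|x IHx]; [apply: Pc; apply: IH|apply: PS].
Qed.

Lemma cfval_SS (x : nat) (t : seq nat) : cfval (x.+2 :: t) = cfval (x.+1 :: t) + 1.
Proof. by case: t => [|y t]; rewrite /= -[in LHS]natr1 // addrAC. Qed.

(** One subtraction read off on numerators: keeping the denominator [b] avoids any reduction to
    lowest terms. *)
Lemma fraction_gt1 (a b : nat) (v : rat) :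
  (0 < b)%N -> 0 < v -> v + 1 = a%:R / b%:R ->
  exists c, [/\ a = (c + b)%N, (0 < c)%N & v = c%:R / b%:R].
Proof.
move=> b0 v0 E; have b0' : (b%:R : rat) != 0 by rewrite pnatr_eq0 -lt0n.
have ba : (b < a)%N.
  rewrite -(ltr_nat rat) -[ltRHS](divfK b0') -E mulrDl mul1r ltrDr.
  by rewrite mulr_gt0 // ltr0n.
exists (a - b)%N; split; rewrite ?subnK ?subn_gt0 //; first exact: ltnW.
by rewrite natrB ?(ltnW ba) // mulrBl divff // -E addrK.
Qed.

Lemma coprime_addl (a b : nat) : coprime (a + b) b = coprime a b.
Proof. by rewrite coprime_sym /coprime gcdnDr gcdnC. Qed.

(** The first variable stays fixed and [L], [m1], [a], [b] are all general, because after each peel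
    the old [m1] serves as [L] and the next summation index as [m1]. *)
Lemma boxsum_fermi (F : fieldType) (q : F) (K : nat) (s : seq nat) :
  not_root_of_unity q -> s != [::] -> all (fun x => 0 < x)%N s ->
  forall (L m1 a b : nat), (m1 <= K)%N -> coprime a b -> (0 < b)%N ->
  cfval s = a%:R / b%:R ->
  boxsum K (dim s).-1 (fun m => fermi q s L (m1 :: m)) =
  q ^ (m1%:Z ^+ 2) * boson q K m1 (L%:Z - m1%:Z) a b.
Proof.
move=> hq; have q0 := hq.1.
(* Positivity of [cfval] is carried along since [fraction_gt1] needs it at every step. *)
suff H : s != [::] -> all (fun x => 0 < x)%N s -> 0 < cfval s /\
  forall (L m1 a b : nat), (m1 <= K)%N -> coprime a b -> (0 < b)%N ->
  cfval s = a%:R / b%:R ->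
  boxsum K (dim s).-1 (fun m => fermi q s L (m1 :: m)) =
  q ^ (m1%:Z ^+ 2) * boson q K m1 (L%:Z - m1%:Z) a b.
  by move=> s0 sp; case: (H s0 sp).
move: s; apply: composition_ind => [|x t [v0 IH]|x t [v0 IH]].
- split=> // L m1 a b m1K cab b0 /= E.
  have eab : a = b.
    apply/eqP; rewrite -(eqr_nat rat) -(divfK (x := b%:R) _ a%:R) -?E ?mul1r //.
    by rewrite pnatr_eq0 -lt0n.
  move: cab; rewrite eab /coprime gcdnn => /eqP ->.
  by rewrite boxsum0 fermi_base boson11 // addrC subrK.
- split=> [|L m1 a b m1K cab b0]; first by rewrite cfval_SS addr_gt0.
  rewrite cfval_SS => /(fraction_gt1 b0 v0) [c [ea _ ev]].
  move: cab; rewrite ea coprime_addl => cab.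
  rewrite (_ : (dim (x.+2 :: t)).-1 = (dim (x.+1 :: t)).-1.+1) // boxsumS.
  rewrite boson_burge_rev // mulr_sumr (big_cat_nat (n := m1.+1)) //=.
  (* The box reaches [K] but Burge's sum stops at [m1]; for i > m1 the inner sum has second argument
     m1 - i < 0 and vanishes. *)
  rewrite [Z in _ + Z]big_nat [Z in _ + Z]big1 ?addr0 => [|i /andP[im iK]]; last first.
    rewrite /boxsum; under eq_bigr => u _ do rewrite fermi_SS //.
    rewrite -mulr_sumr.
    have := IH m1 i c b; rewrite /boxsum => -> //; rewrite boson_M_lt0 ?mulr0 //; lia.
  rewrite !big_nat; apply: eq_bigr => i /andP[_ im].
  rewrite /boxsum; under eq_bigr => u _ do rewrite fermi_SS //.
  rewrite -mulr_sumr; have := IH m1 i c b; rewrite /boxsum => -> //; last by lia.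
  have -> : m1%:Z + (L%:Z - m1%:Z) + i%:Z = L%:Z + i%:Z by ring.
  rewrite mulrACA -expfzDr // !mulrA -expfzDr //.
  by congr (q ^ _ * _ * _); ring.
- split=> [|L m1 a b m1K cab b0].
    by rewrite -[cfval _]/(1 + (cfval (x.+1 :: t))^-1) addr_gt0 ?invr_gt0.
  have vi : 0 < (cfval (x.+1 :: t))^-1 by rewrite invr_gt0.
  rewrite -[cfval _]/(1 + (cfval (x.+1 :: t))^-1) addrC.
  (* Inverting the tail exchanges numerator and denominator, hence the swapped form of the
     transform. *)
  move=> /(fraction_gt1 b0 vi) [c [ea c0 /(congr1 (fun z => z^-1))]].
  rewrite invrK invf_div => ev.
  move: cab; rewrite ea coprime_addl coprime_sym => cab.
  rewrite (_ : (dim [:: 1%N, x.+1 & t]).-1 = (dim (x.+1 :: t)).-1.+1) // boxsumS.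
  rewrite boson_burge_swap // mulr_sumr (big_cat_nat (n := m1.+1)) //=.
  rewrite [Z in _ + Z]big_nat [Z in _ + Z]big1 ?addr0 => [|i /andP[im iK]]; last first.
    rewrite /boxsum; under eq_bigr => u _ do rewrite fermi_1 //.
    rewrite -mulr_sumr.
    have := IH m1 i b c; rewrite /boxsum => -> //.
    rewrite boson_M_lt0 ?mulr0 //; lia.
  rewrite !big_nat; apply: eq_bigr => i /andP[_ im].
  rewrite /boxsum; under eq_bigr => u _ do rewrite fermi_1 //.
  rewrite -mulr_sumr; have := IH m1 i b c; rewrite /boxsum => -> //; last by lia.
  have -> : 2 * m1%:Z + (L%:Z - m1%:Z) - i%:Z = L%:Z + m1%:Z - i%:Z by ring.
  by rewrite mulrACA !mulrA.
Qed.

(** * Support of the summand and the final assembly *)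

Lemma qbin_neq0_le (F : fieldType) (q : F) (N m : int) : qbin q N m != 0 -> m <= N.
Proof. by apply: contraNT; rewrite -ltNge => /qbin_small ->. Qed.

(** By induction the later variables are at most [m1]; the first q-binomial gives 2 m1 <= L + m2 or
    m1 + m2 <= L, and either yields m1 <= L. *)
Lemma fermi_support (F : fieldType) (q : F) (s : seq nat) :
  q != 0 -> s != [::] -> all (fun x => 0 < x)%N s ->
  forall (L m1 : nat) (m : seq nat), size m = (dim s).-1 ->
  fermi q s L (m1 :: m) != 0 -> all (fun k => k <= L)%N (m1 :: m).
Proof.
move=> q0; move: s; apply: composition_ind => [|x t IH|x t IH] L m1 m sm.
- have /nilP -> : size m == 0%N by rewrite sm.
  by rewrite fermi_base mulf_eq0 negb_or => /andP[_ /qbin_neq0_le] /=; lia.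
- case: m sm => [|m2 m]; first by rewrite /dim /= addSn.
  move=> [sm]; rewrite fermi_SS // mulf_eq0 negb_or mulf_eq0 negb_or -andbA.
  case/and3P=> _ /qbin_neq0_le le /IH -/(_ sm) le'.
  have m1L : (m1 <= L)%N by case/andP: le'; lia.
  by apply/andP; split=> //; apply: sub_all le' => k /leq_trans; apply.
- case: m sm => [|m2 m]; first by rewrite /dim /= addSn.
  move=> [sm]; rewrite fermi_1 // mulf_eq0 negb_or mulf_eq0 negb_or -andbA.
  case/and3P=> _ /qbin_neq0_le le /IH -/(_ sm) le'.
  have m1L : (m1 <= L)%N by case/andP: le'; lia.
  by apply/andP; split=> //; apply: sub_all le' => k /leq_trans; apply.
Qed.

(** Burge's kernel without the factor q^(m1^2), which [boxsum_fermi] supplies; in the second case (L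
    - m1)^2 = L(L - 2 m1) + m1^2. *)
Definition burge_kernel {F : fieldType} (q : F) (L M a b m1 : nat) : F :=
  if (a <= 2 * b)%N then qbin q (2 * L%:Z + M%:Z - m1%:Z) (2 * L%:Z)
  else q ^ (L%:Z * (L%:Z - 2 * m1%:Z)) * qbin q (L%:Z + M%:Z + m1%:Z) (2 * L%:Z).

Lemma rhs_termE (F : fieldType) (q : F) (s : seq nat) (L M a b : nat)
    (m : (dim s).-tuple nat) :
  q != 0 -> rhs_term q s L M a b m = burge_kernel q L M a b (nth 0%N m 0) * fermi q s L m.
Proof.
move=> q0; rewrite /rhs_term /burge_kernel /fermi; case: ifP => _;
  rewrite ?expfzDr // -[mj m 1]/((nth 0%N m 0)%:Z); ring.
Qed.

(** The two branches are the pairs reached by [boson_burge_swap] and [boson_burge_rev] from (a, b);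
    at a = 2b both fractions equal 1. *)
Lemma cfab_tail (a b : nat) : (1 <= b)%N -> (b < a)%N ->
  cfab a b = if (a <= 2 * b)%N then b%:R / (a - b)%:R else (a - b)%:R / b%:R.
Proof.
move=> b0 ba; have b0' : (b%:R : rat) != 0 by rewrite pnatr_eq0 -lt0n.
have E : a%:R / b%:R - 1 = (a - b)%:R / b%:R :> rat.
  by rewrite natrB ?(ltnW ba) // mulrBl divff.
rewrite /cfab E /cf_sign; case: (ltngtP a (2 * b)) => h /=.
- by rewrite exprN1 invf_div.
- by rewrite expr1z.
- by rewrite expr0z h mul2n -addnn addnK divff.
Qed.

Theorem theorem7p1 (F : fieldType) (q : F) (L M a b : nat) (s : seq nat) :
  q != 0 -> (forall i : nat, (0 < i)%N -> q ^+ i != 1) ->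
  coprime a b -> (1 <= b)%N -> (b < a)%N ->
  is_cf_expansion a b s ->
  exists v : F, has_fsum (lhs_term q L M a b) v /\ has_fsum (rhs_term q s L M a b) v.
Proof.
move=> q0 hq' cab b0 ba [s0 sp cfs _].
have hq : not_root_of_unity q by [].
(* K = L suffices: |j| > L forces |aj| > L, where [Bfun] vanishes, and the outermost summation index
   is at most [L]. *)
exists (boson q L L M a b); split.
  exists [seq i%:Z - L%:Z | i <- iota 0 L.*2.+1]; split.
  - by rewrite map_inj_uniq ?iota_uniq // => i j /= /addIr [].
  - move=> j jS; rewrite /lhs_term Bfun_L_small ?mulr0 //.
    have jL : (L < `|j|)%N.
      rewrite ltnNge; apply: contra jS => jL; apply/mapP.
      by exists (absz (j + L%:Z)); rewrite ?mem_iota; lia.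
    have : (0 < a)%N by apply: leq_trans ba.
    by rewrite normrM; nia.
  - by rewrite big_map.
pose g (m : seq nat) := burge_kernel q L M a b (nth 0%N m 0) * fermi q s L m.
have sd : dim s = (dim s).-1.+1.
  by case: s s0 sp {cfs g} => // -[|x] t; rewrite // /dim /= addSn.
(* One outermost Burge step produces the kernel and the sum over m_1; [boxsum_fermi] evaluates the
   remaining sums. *)
have -> : boson q L L M a b = boxsum L (dim s) g.
  rewrite sd boxsumS /g /=.
  have {}cfs := etrans cfs (cfab_tail b0 ba).
  have [c ea] : exists c, a = (c + b)%N by exists (a - b)%N; rewrite subnK // ltnW.
  move: cab ba cfs; rewrite ea coprime_addl addnK => cab ba cfs.
  rewrite /burge_kernel; case: ifP cfs => _ cfs.
    rewrite boson_burge_swap //; rewrite !big_nat; apply: eq_bigr => i /andP[_ iL].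
    rewrite /boxsum -mulr_sumr -/(boxsum L (dim s).-1 (fun m => fermi q s L (i :: m))).
    rewrite (boxsum_fermi hq s0 sp _ _ _ _ cfs) ?(coprime_sym b) //; [|lia].
    by rewrite (exprnP q); ring.
  rewrite boson_burge_rev // !big_nat; apply: eq_bigr => i /andP[_ iL].
  rewrite /boxsum -mulr_sumr -/(boxsum L (dim s).-1 (fun m => fermi q s L (i :: m))).
  rewrite (boxsum_fermi hq s0 sp _ _ _ _ cfs) //.
  rewrite mulrACA -expfzDr // -mulrA; congr (q ^ _ * _); ring.
have supp (m : (dim s).-tuple nat) : g m != 0 -> all (fun k => k <= L)%N m.
  case: m => [[|m1 m] /= ms]; first by [].
  rewrite mulf_eq0 negb_or => /andP[_]; apply: fermi_support => //.
  by rewrite -(eqP ms).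
have [S [uS zS vS]] := has_fsum_box supp.
exists S; split=> // [m /zS|]; first by rewrite rhs_termE.
by rewrite vS; apply: eq_bigr => m _; rewrite rhs_termE.
Qed.
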